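(* Suppose $\theta>0$ and $n\in(1,3)$. Then the solution $H\in C^1([0,1])\cap C^3((0,1))$ of the problem $$H^{n-1}\frac{d^3H}{dx^3}=-1+x\ \text{ for } x\in(0,1),\qquad \Big(H,\frac{dH}{dx}\Big)=(0,\theta)\ \text{ at } x=0,\qquad \frac{dH}{dx}=0\ \text{ at } x=1$$ is unique.
   Context: The unknown $H$ is the height of a film and the differential equation is understood on the set where $H>0$; thus a (classical) solution is a function $H\in C^1([0,1])\cap C^3((0,1))$ that is positive on $(0,1)$ and satisfies the equation and boundary conditions. *)

(* Defs.v *)
From Stdlib Require Import Reals.
From Coquelicot Require Import Coquelicot.
Open Scope R_scope.

Definition segment (a b x : R) : Prop := a <= x <= b.

(* The value of [f] outside the segment is irrelevant: [D_in] and [continue_in]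
   only look at points of the segment, so they are one-sided at [a] and [b]. *)
Definition C1_closed (a b : R) (f : R -> R) : Prop :=
  exists f' : R -> R, forall x : R, segment a b x ->
    D_in f f' (segment a b) x /\ continue_in f' (segment a b) x.

Definition Ck_open (k : nat) (a b : R) (f : R -> R) : Prop :=
  forall x : R, a < x < b ->
    (forall j : nat, (j <= k)%nat -> ex_derive_n f j x) /\
    continuous (Derive_n f k) x.

(* [D_in H (fun _ => l) S x] says that the derivative of [H] at [x], relative
   to [S], is [l]. *)
Record is_solution (theta n : R) (H : R -> R) : Prop := {
  sol_C1 : C1_closed 0 1 H;
  sol_C3 : Ck_open 3 0 1 H;
  sol_pos : forall x : R, 0 < x < 1 -> 0 < H x;
  sol_eqn : forall x : R, 0 < x < 1 ->
    Rpower (H x) (n - 1) * Derive_n H 3 x = -1 + x;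
  sol_bc0 : H 0 = 0;
  sol_bc0' : D_in H (fun _ => theta) (segment 0 1) 0;
  sol_bc1' : D_in H (fun _ => 0) (segment 0 1) 1
}.

(* Main.v *)
(** Put [w = H1 - H2].  As [t |-> - t^(1-n)] is nondecreasing, [w * w''' >= 0],
    so the energy [E = w * w'' - w'^2 / 2] is nondecreasing on (0,1).  It is
    nonnegative, although [w''] may blow up at 0: if [E <= -2e < 0] near 0, then
    [(w * w')' = E + 3/2 * w'^2 < 0] there, so [w * w' <= 0], so [w^2 <= 0],
    and [w = 0] gives [E = - w'^2 / 2], which is close to 0.
    Hence [(w * w')' >= 0] on (0,1), and since [w * w'] vanishes at
    both ends, [w^2] is constant. *)

Require Import Defs.
From Stdlib Require Import Reals Lra.
From Coquelicot Require Import Coquelicot.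
Open Scope R_scope.

(** * Monotonicity and limits at the ends of an open interval *)

Lemma is_derive_nonneg_incr (a b : R) (f df : R -> R) :
  (forall x, a < x < b -> is_derive f x (df x)) ->
  (forall x, a < x < b -> 0 <= df x) ->
  forall x y, a < x -> x <= y -> y < b -> f x <= f y.
Proof.
  intros Hd Hp x y Hx Hxy Hy.
  destruct (MVT_gen f x y df) as [c [Hc Heq]];
    rewrite ?Rmin_left, ?Rmax_right in * by lra.
  - intros z Hz; apply Hd; lra.
  - intros z Hz; apply derivable_continuous_pt.
    exists (df z); apply is_derive_Reals, Hd; lra.
  - assert (0 <= df c * (y - x)) by (apply Rmult_le_pos; [apply Hp|]; lra).
    lra.
Qed.

(** For [y] in [(a, x)] monotonicity gives [f y <= f x]; let [y] tend to [a]. Working with the limit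
    avoids any assumption on the value [f a]. *)
Lemma is_derive_nonneg_ge_lim (a b l : R) (f df : R -> R) :
  (forall x, a < x < b -> is_derive f x (df x)) ->
  (forall x, a < x < b -> 0 <= df x) ->
  filterlim f (at_right a) (locally l) ->
  forall x, a < x < b -> l <= f x.
Proof.
  intros Hd Hp Hl x Hx.
  apply (filterlim_le (F := at_right a) f (fun _ => f x) (Finite l) (Finite (f x)));
    [| exact Hl | apply filterlim_const].
  assert (He : 0 < x - a) by lra.
  exists (mkposreal _ He); intros y Hy Hay.
  apply Rabs_lt_between' in Hy; simpl in Hy.
  apply (is_derive_nonneg_incr a b f df); auto; lra.
Qed.

Lemma is_derive_nonneg_le_lim (a b l : R) (f df : R -> R) :
  (forall x, a < x < b -> is_derive f x (df x)) ->
  (forall x, a < x < b -> 0 <= df x) ->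
  filterlim f (at_left b) (locally l) ->
  forall x, a < x < b -> f x <= l.
Proof.
  intros Hd Hp Hl x Hx.
  apply (filterlim_le (F := at_left b) (fun _ => f x) f (Finite (f x)) (Finite l));
    [| apply filterlim_const | exact Hl].
  assert (He : 0 < b - x) by lra.
  exists (mkposreal _ He); intros y Hy Hay.
  apply Rabs_lt_between' in Hy; simpl in Hy.
  apply (is_derive_nonneg_incr a b f df); auto; lra.
Qed.

Lemma filterlim_mult_R (F : (R -> Prop) -> Prop) {FF : Filter F}
    (f g : R -> R) (l m : R) :
  filterlim f F (locally l) -> filterlim g F (locally m) ->
  filterlim (fun x => f x * g x) F (locally (l * m)).
Proof.
  intros Hf Hg.
  exact (filterlim_comp_2 f g Rmult Hf Hg (filterlim_mult (K := R_AbsRing) l m)).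
Qed.

Lemma filterlim_minus_R (F : (R -> Prop) -> Prop) {FF : Filter F}
    (f g : R -> R) (l m : R) :
  filterlim f F (locally l) -> filterlim g F (locally m) ->
  filterlim (fun x => f x - g x) F (locally (l - m)).
Proof.
  intros Hf Hg.
  refine (filterlim_comp_2 f (fun x => - g x) Rplus Hf _
            (filterlim_plus (V := R_NormedModule) l (- m))).
  exact (filterlim_comp _ _ _ _ _ _ _ _ Hg (filterlim_opp (V := R_NormedModule) m)).
Qed.

Lemma is_derive_mult_R (f g : R -> R) (x df dg : R) :
  is_derive f x df -> is_derive g x dg ->
  is_derive (fun y => f y * g y) x (df * g x + f x * dg).
Proof.
  intros Hf Hg; apply (is_derive_mult f g); auto using Rmult_comm.
Qed.

(** * Energy argument for a function whose product with its third derivative is nonnegative *)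

Section ThirdOrder.

Variables (a b l : R) (w p q r : R -> R).
Hypothesis dw : forall x, a < x < b -> is_derive w x (p x).
Hypothesis dp : forall x, a < x < b -> is_derive p x (q x).
Hypothesis dq : forall x, a < x < b -> is_derive q x (r x).
Hypothesis wr : forall x, a < x < b -> 0 <= w x * r x.
Hypothesis w_a : filterlim w (at_right a) (locally 0).
Hypothesis p_a : filterlim p (at_right a) (locally 0).
Hypothesis w_b : filterlim w (at_left b) (locally l).
Hypothesis p_b : filterlim p (at_left b) (locally 0).

Let energy x := w x * q x - p x * p x / 2.

Let is_derive_wp x : a < x < b -> is_derive (fun y => w y * p y) x (p x * p x + w x * q x).
Proof. intros Hx; apply is_derive_mult_R; auto. Qed.

Let is_derive_ww x : a < x < b -> is_derive (fun y => w y * w y) x (2 * (w x * p x)).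
Proof.
  intros Hx.
  replace (2 * (w x * p x)) with (p x * w x + w x * p x) by ring.
  apply is_derive_mult_R; auto.
Qed.

(** The terms [p x * q x] coming from [w * q] and from [p * p / 2] cancel. *)
Let is_derive_energy x : a < x < b -> is_derive energy x (w x * r x).
Proof.
  intros Hx; unfold energy, Rdiv.
  replace (w x * r x) with
    ((p x * q x + w x * r x) - ((q x * p x + p x * q x) * / 2 + p x * p x * 0)) by field.
  apply (is_derive_minus (fun y => w y * q y) (fun y => p y * p y * / 2)).
  - apply is_derive_mult_R; auto.
  - apply (is_derive_mult_R (fun y => p y * p y) (fun _ => / 2)).
    + apply is_derive_mult_R; auto.
    + apply (is_derive_const (/ 2)).
Qed.

Let ww_a : filterlim (fun y => w y * w y) (at_right a) (locally 0).
Proof. rewrite <- (Rmult_0_l 0); apply filterlim_mult_R; auto; apply at_right_proper_filter. Qed.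

Let wp_a : filterlim (fun y => w y * p y) (at_right a) (locally 0).
Proof. rewrite <- (Rmult_0_l 0); apply filterlim_mult_R; auto; apply at_right_proper_filter. Qed.

Let energy_nonneg x : a < x < b -> 0 <= energy x.
Proof.
  intros Hx; apply Rnot_lt_le; intros Hneg.
  (* If [p y * p y] is below this bound and [energy y <= energy x], then [p y * p y + w y * q y],
     which is [energy y + 3/2 * (p y * p y)], is less than [energy x / 4 < 0]. *)
  assert (He : 0 < - energy x / 2) by lra.
  assert (pp_a : filterlim (fun y => p y * p y) (at_right a) (locally 0)).
  { rewrite <- (Rmult_0_l 0); apply filterlim_mult_R; auto; apply at_right_proper_filter. }
  destruct (proj1 (filterlim_locally _ _) pp_a (mkposreal _ He)) as [d Hd].
  (* Below [a + d] the square of [p] is small; below [x] the energy is at most [energy x]. *)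
  set (c := Rmin (a + d) x).
  assert (Hc : a < c /\ c <= a + d /\ c <= x).
  { pose proof (cond_pos d); unfold c; repeat split.
    - apply Rmin_glb_lt; lra.
    - apply Rmin_l.
    - apply Rmin_r. }
  assert (Hpp : forall y, a < y < c -> p y * p y < - energy x / 2).
  { intros y Hy.
    assert (By : ball a d y) by (apply Rabs_lt_between'; lra).
    specialize (Hd y By (proj1 Hy)).
    apply Rabs_lt_between' in Hd; simpl in Hd; lra. }
  assert (HE : forall y, a < y < c -> energy y <= energy x).
  { intros y Hy; apply (is_derive_nonneg_incr a b energy (fun x => w x * r x)); auto; lra. }
  assert (Hwp : forall y, a < y < c -> 0 <= - (w y * p y)).
  { apply (is_derive_nonneg_ge_lim a c 0 _ (fun y => - (p y * p y + w y * q y))).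
    - intros y Hy; apply (is_derive_opp (fun y => w y * p y)), is_derive_wp; lra.
    - intros y Hy; specialize (Hpp y Hy); specialize (HE y Hy).
      unfold energy at 1 in HE; lra.
    - rewrite <- Ropp_0.
      exact (filterlim_comp _ _ _ _ _ _ _ _ wp_a (filterlim_opp (V := R_NormedModule) 0)). }
  assert (Hww : forall y, a < y < c -> 0 <= - (w y * w y)).
  { apply (is_derive_nonneg_ge_lim a c 0 _ (fun y => - (2 * (w y * p y)))).
    - intros y Hy; apply (is_derive_opp (fun y => w y * w y)), is_derive_ww; lra.
    - intros y Hy; specialize (Hwp y Hy); lra.
    - rewrite <- Ropp_0.
      exact (filterlim_comp _ _ _ _ _ _ _ _ ww_a (filterlim_opp (V := R_NormedModule) 0)). }
  (* Any point of [(a, c)] gives the contradiction: there [w y = 0], so [energy y = - (p y * p y) /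
     2 > energy x / 4 > energy x]. *)
  assert (Hy : a < (a + c) / 2 < c) by lra.
  set (y := (a + c) / 2) in Hy.
  specialize (Hww y Hy); specialize (HE y Hy); specialize (Hpp y Hy).
  assert (Hw0 : w y = 0) by nra.
  unfold energy at 1 in HE; rewrite Hw0 in HE; lra.
Qed.

Lemma third_order_eq0 x : a < x < b -> w x = 0.
Proof.
  assert (Hd : forall y, a < y < b -> 0 <= p y * p y + w y * q y).
  { intros y Hy; generalize (energy_nonneg y Hy); unfold energy; nra. }
  (* The limit [l] of [w] at [b] is arbitrary but finite, so the factor [p] drives the product to
     0. *)
  assert (wp_b : filterlim (fun y => w y * p y) (at_left b) (locally 0)).
  { rewrite <- (Rmult_0_r l); apply filterlim_mult_R; auto; apply at_left_proper_filter. }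
  assert (Hwp : forall y, a < y < b -> w y * p y = 0).
  (* A nondecreasing function with limit 0 at both ends is squeezed to 0. *)
  { intros y Hy; apply Rle_antisym.
    - apply (is_derive_nonneg_le_lim a b 0 (fun y => w y * p y)
        (fun y => p y * p y + w y * q y)); auto.
    - apply (is_derive_nonneg_ge_lim a b 0 (fun y => w y * p y)
        (fun y => p y * p y + w y * q y)); auto. }
  intros Hx.
  assert (0 <= - (w x * w x)).
  { apply (is_derive_nonneg_ge_lim a b 0 (fun y => - (w y * w y)) (fun y => - (2 * (w y * p y)))); auto.
    - intros y Hy; apply (is_derive_opp (fun y => w y * w y)), is_derive_ww; lra.
    - intros y Hy; rewrite Hwp by auto; lra.
    - rewrite <- Ropp_0.
      exact (filterlim_comp _ _ _ _ _ _ _ _ ww_a (filterlim_opp (V := R_NormedModule) 0)). }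
  nra.
Qed.

End ThirdOrder.

(** * From limits relative to a segment to one-sided filters *)

Lemma continue_in_segment_at_right (a b : R) (f : R -> R) :
  a < b -> continue_in f (segment a b) a ->
  filterlim f (at_right a) (locally (f a)).
Proof.
  intros Hab Hf; apply filterlim_locally; intros e.
  destruct (Hf e (cond_pos e)) as [d [Hd Hlim]].
  (* The cap [b - a] keeps the nearby points inside the segment. *)
  assert (Hm : 0 < Rmin d (b - a)) by (apply Rmin_glb_lt; lra).
  exists (mkposreal _ Hm); intros y Hy Hay.
  pose proof (Rmin_l d (b - a)); pose proof (Rmin_r d (b - a)).
  change (Rabs (y - a) < Rmin d (b - a)) in Hy.
  apply Hlim; repeat split; try lra.
  - apply Rabs_lt_between' in Hy; lra.
  - simpl; unfold R_dist; lra.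
Qed.

Lemma continue_in_segment_at_left (a b : R) (f : R -> R) :
  a < b -> continue_in f (segment a b) b ->
  filterlim f (at_left b) (locally (f b)).
Proof.
  intros Hab Hf; apply filterlim_locally; intros e.
  destruct (Hf e (cond_pos e)) as [d [Hd Hlim]].
  assert (Hm : 0 < Rmin d (b - a)) by (apply Rmin_glb_lt; lra).
  exists (mkposreal _ Hm); intros y Hy Hyb.
  pose proof (Rmin_l d (b - a)); pose proof (Rmin_r d (b - a)).
  change (Rabs (y - b) < Rmin d (b - a)) in Hy.
  apply Hlim; repeat split; try lra.
  - apply Rabs_lt_between' in Hy; lra.
  - simpl; unfold R_dist; lra.
Qed.

(** Limits are unique because [x] is an accumulation point of a nondegenerate segment, even at its
    ends. *)
Lemma D_in_segment_unique (a b x : R) (f d1 d2 : R -> R) :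
  a < b -> segment a b x ->
  D_in f d1 (segment a b) x -> D_in f d2 (segment a b) x -> d1 x = d2 x.
Proof.
  intros Hab Hx D1 D2.
  refine (single_limit _ _ _ _ _ _ D1 D2).
  intros e He; unfold segment in Hx.
  (* A step of at most half the length, taken away from the nearer end, stays in the segment;
     [e / 2] makes the distance strictly less than [e]. *)
  set (h := Rmin (e / 2) ((b - a) / 2)).
  assert (Hh : 0 < h /\ h <= e / 2 /\ h <= (b - a) / 2).
  { repeat split; [apply Rmin_glb_lt; lra | apply Rmin_l | apply Rmin_r]. }
  destruct (Rle_lt_dec x ((a + b) / 2)).
  - exists (x + h); unfold D_x, segment, R_dist; repeat split; try lra.
    apply Rabs_def1; lra.
  - exists (x - h); unfold D_x, segment, R_dist; repeat split; try lra.
    apply Rabs_def1; lra.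
Qed.

Lemma is_derive_D_in (D : R -> Prop) (f d : R -> R) (x : R) :
  is_derive f x (d x) -> D_in f d D x.
Proof.
  intros Hf; apply is_derive_Reals, derivable_pt_lim_D_in in Hf.
  intros e He; destruct (Hf e He) as [h [Hh Hlim]].
  exists h; split; [exact Hh|].
  intros y [[_ Hy] Hyh]; apply Hlim; repeat split; auto.
Qed.

(** * Limits of a solution and of its derivative at 0 and 1 *)

Section Solution.

Variables (theta n : R) (H : R -> R).
Hypothesis sol : is_solution theta n H.

Lemma solution_is_derive_n (k : nat) (x : R) :
  (k <= 2)%nat -> 0 < x < 1 -> is_derive (Derive_n H k) x (Derive_n H (S k) x).
Proof.
  intros Hk Hx.
  (* [ex_derive_n H (S k) x] unfolds to differentiability of [Derive_n H k] at [x]. *)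
  apply Derive_correct, (proj1 (sol_C3 _ _ _ sol x Hx) (S k)), le_n_S, Hk.
Qed.

Lemma solution_lim_0 : filterlim H (at_right 0) (locally 0).
Proof.
  rewrite <- (sol_bc0 _ _ _ sol) at 2.
  apply (continue_in_segment_at_right 0 1); [lra|].
  exact (cont_deriv _ _ _ _ (sol_bc0' _ _ _ sol)).
Qed.

Lemma solution_lim_1 : filterlim H (at_left 1) (locally (H 1)).
Proof.
  apply (continue_in_segment_at_left 0 1); [lra|].
  exact (cont_deriv _ _ _ _ (sol_bc1' _ _ _ sol)).
Qed.

Lemma solution_C1_Derive (H' : R -> R) (x : R) :
  (forall y, segment 0 1 y ->
     D_in H H' (segment 0 1) y /\ continue_in H' (segment 0 1) y) ->
  0 < x < 1 -> H' x = Derive H x.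
Proof.
  intros HC Hx.
  assert (Hs : segment 0 1 x) by (unfold segment; lra).
  apply (D_in_segment_unique 0 1 x H H' (Derive H)); auto; try lra.
  - apply HC, Hs.
  - apply is_derive_D_in, (solution_is_derive_n 0); auto.
Qed.

(** [Derive H 0] carries no information, as [H] is arbitrary outside the segment. The limit comes
    from the continuous relative derivative [H'], which equals [theta] at 0 and [Derive H]
    inside. *)
Lemma solution_Derive_lim_0 : filterlim (Derive H) (at_right 0) (locally theta).
Proof.
  destruct (sol_C1 _ _ _ sol) as [H' HC].
  assert (Hs : segment 0 1 0) by (unfold segment; lra).
  assert (H0 : H' 0 = theta).
  { apply (D_in_segment_unique 0 1 0 H H' (fun _ => theta)); auto; try lra.
    - apply HC, Hs.
    - apply (sol_bc0' _ _ _ sol). }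
  rewrite <- H0.
  apply (filterlim_ext_loc H').
  - exists (mkposreal 1 Rlt_0_1); intros y Hy Hpos.
    apply Rabs_lt_between' in Hy; simpl in Hy.
    apply solution_C1_Derive; auto; lra.
  - apply (continue_in_segment_at_right 0 1); [lra|]; apply HC, Hs.
Qed.

Lemma solution_Derive_lim_1 : filterlim (Derive H) (at_left 1) (locally 0).
Proof.
  destruct (sol_C1 _ _ _ sol) as [H' HC].
  assert (Hs : segment 0 1 1) by (unfold segment; lra).
  assert (H0 : H' 1 = 0).
  { apply (D_in_segment_unique 0 1 1 H H' (fun _ => 0)); auto; try lra.
    - apply HC, Hs.
    - apply (sol_bc1' _ _ _ sol). }
  rewrite <- H0.
  apply (filterlim_ext_loc H').
  - exists (mkposreal 1 Rlt_0_1); intros y Hy Hpos.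
    apply Rabs_lt_between' in Hy; simpl in Hy.
    apply solution_C1_Derive; auto; lra.
  - apply (continue_in_segment_at_left 0 1); [lra|]; apply HC, Hs.
Qed.

End Solution.

(** * Comparison of two solutions and uniqueness *)

Lemma solution_Derive3_le (theta n : R) (H1 H2 : R -> R) (x : R) :
  1 <= n -> is_solution theta n H1 -> is_solution theta n H2 ->
  0 < x < 1 -> H1 x <= H2 x -> Derive_n H1 3 x <= Derive_n H2 3 x.
Proof.
  intros Hn S1 S2 Hx Hle.
  pose proof (sol_pos _ _ _ S1 x Hx) as P1.
  pose proof (sol_eqn _ _ _ S1 x Hx) as E1.
  pose proof (sol_eqn _ _ _ S2 x Hx) as E2.
  assert (HR : Rpower (H1 x) (n - 1) <= Rpower (H2 x) (n - 1))
    by (apply Rle_Rpower_l; lra).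
  assert (0 < Rpower (H1 x) (n - 1)) by apply exp_pos.
  set (A := Rpower (H1 x) (n - 1)) in *; set (B := Rpower (H2 x) (n - 1)) in *.
  set (u := Derive_n H1 3 x) in *; set (v := Derive_n H2 3 x) in *.
  (* Here [A * u = B * v = -1 + x < 0] with [0 < A <= B]. This forces [v <= 0], and then [v < u]
     would give [B * v <= A * v < A * u]. *)
  assert (Hv : v <= 0) by (apply Rnot_lt_le; intros Hv; nra).
  apply Rnot_lt_le; intros Huv; nra.
Qed.

Theorem proposition5p5 (theta n : R) (theta_pos : 0 < theta) (n_range : 1 < n < 3)
  (H1 H2 : R -> R)
  (sol1 : is_solution theta n H1) (sol2 : is_solution theta n H2) :
  forall x : R, 0 <= x <= 1 -> H1 x = H2 x.
Proof.
  assert (Hder : forall k x, (k <= 2)%nat -> 0 < x < 1 ->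
    is_derive (fun y => Derive_n H1 k y - Derive_n H2 k y) x
      (Derive_n H1 (S k) x - Derive_n H2 (S k) x)).
  { intros k x Hk Hx.
    apply (is_derive_minus (Derive_n H1 k) (Derive_n H2 k));
      eapply solution_is_derive_n; eauto. }
  assert (w_b : filterlim (fun y => H1 y - H2 y) (at_left 1) (locally (H1 1 - H2 1))).
  { apply filterlim_minus_R; [apply at_left_proper_filter | |];
      eapply solution_lim_1; eauto. }
  assert (Hin : forall x, 0 < x < 1 -> H1 x - H2 x = 0).
  { apply (third_order_eq0 0 1 (H1 1 - H2 1) (fun y => H1 y - H2 y)
      (fun y => Derive H1 y - Derive H2 y)
      (fun y => Derive_n H1 2 y - Derive_n H2 2 y)
      (fun y => Derive_n H1 3 y - Derive_n H2 3 y)); auto.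
    - intros x Hx; apply (Hder 0%nat x); auto.
    - intros x Hx; apply (Hder 1%nat x); auto.
    - intros x Hx.
      assert (Hn : 1 <= n) by lra.
      (* By symmetry of the comparison, the differences of the values and of the third derivatives
         never have opposite signs. *)
      destruct (Rle_dec (H1 x) (H2 x)) as [Hle | Hgt].
      + pose proof (solution_Derive3_le _ _ _ _ x Hn sol1 sol2 Hx Hle); nra.
      + assert (Hle : H2 x <= H1 x) by lra.
        pose proof (solution_Derive3_le _ _ _ _ x Hn sol2 sol1 Hx Hle); nra.
    - rewrite <- (Rminus_diag 0) at 2.
      apply filterlim_minus_R; [apply at_right_proper_filter | |];
        eapply solution_lim_0; eauto.
    - rewrite <- (Rminus_diag theta) at 2.
      apply filterlim_minus_R; [apply at_right_proper_filter | |];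
        eapply solution_Derive_lim_0; eauto.
    - rewrite <- (Rminus_diag 0).
      apply filterlim_minus_R; [apply at_left_proper_filter | |];
        eapply solution_Derive_lim_1; eauto. }
  intros x Hx.
  destruct (Req_dec x 0) as [-> | Hx0].
  { rewrite (sol_bc0 _ _ _ sol1), (sol_bc0 _ _ _ sol2); reflexivity. }
  destruct (Req_dec x 1) as [-> | Hx1].
  { apply Rminus_diag_uniq.
    (* The value at 1 is not prescribed, so equality there follows by continuity from the
       interior. *)
    apply (filterlim_locally_unique (F := at_left 1) (fun y => H1 y - H2 y) _ _ w_b).
    apply (filterlim_ext_loc (fun _ => 0)); [| apply filterlim_const].
    exists (mkposreal 1 Rlt_0_1); intros y Hy Hy1.
    apply Rabs_lt_between' in Hy; simpl in Hy.
    symmetry; apply Hin; lra. }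
  apply Rminus_diag_uniq, Hin; lra.
Qed.
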